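(* Let $(X,d)$ be a bicomplete quasi-pseudometric space. Let $F:X\to CB(X)$ be a set-valued map that satisfies $H(Fx,Fy)\le\psi(d(x,y))$ for each $x,y\in X$, where $\psi:[0,\infty)\to[0,\infty)$ is upper semicontinuous, $\psi(t)<t$ for each $t>0$, and $\liminf_{t\to\infty}(t-\psi(t))>0$. If $F$ has the approximate mix-point property, then $F$ has a fixed point, i.e. there is $x\in X$ with $x\in Fx$.
   Context: A quasi-pseudometric on a nonempty set $X$ is a function $d:X\times X\to[0,\infty)$ with $d(x,x)=0$ and $d(x,z)\le d(x,y)+d(y,z)$ for all $x,y,z\in X$. It is a $T_0$-quasi-pseudometric if moreover $d(x,y)=0=d(y,x)$ implies $x=y$; then $d^s(x,y)=\max\{d(x,y),d(y,x)\}$ is a metric. $(X,d)$ is bicomplete if $d$ is a $T_0$-quasi-pseudometric and the metric $d^s$ is complete. A subset $A\subseteq X$ is bounded if there is $M>0$ with $d(x,y)<M$ for all $x,y\in A$. $CB(X)$ is the collection of all nonempty bounded subsets of $X$ that are closed with respect to the topology $\tau(d^s)$ of $d^s$. For nonempty $A,B\subseteq X$ and $x\in X$: $d(x,A)=\inf_{a\in A}d(x,a)$, $d(A,x)=\inf_{a\in A}d(a,x)$, and $H(A,B)=\max\{\sup_{a\in A}d(a,B),\ \sup_{b\in B}d(A,b)\}$. $F$ has the approximate mix-point property if $\inf_{x\in X}\sup_{y\in Fx}d^s(x,y)=0$.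
   Formalization: The formal theorem adds the hypothesis ψ(0)=0; without it the claim fails, e.g. X=ℝ, d(x,y)=max(y−x,0), ψ(0)=1, ψ(t)=t/(1+t) for t>0, Fx={x/(1+x)} for x>0 and Fx={1} for x≤0. *)

(* Defs.v *)
From HB Require Import structures.
From mathcomp Require Import all_boot all_order all_algebra.
From mathcomp Require Import all_classical all_reals all_analysis.
Set Implicit Arguments.
Unset Strict Implicit.
Unset Printing Implicit Defensive.
Import Order.TTheory GRing.Theory Num.Theory.
Import numFieldNormedType.Exports.

Local Open Scope classical_set_scope.
Local Open Scope ring_scope.

Record is_quasi_pseudometric (R : realType) (X : Type) (d : X -> X -> R) :
    Prop := {
  qpm_ge0 : forall x y, 0 <= d x y ;
  qpm_refl : forall x, d x x = 0 ;
  qpm_triangle : forall x y z, d x z <= d x y + d y z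
}.

Record T0_quasi_pseudometric (R : realType) (X : Type) := {
  qdist :> X -> X -> R ;
  qdist_qpm : is_quasi_pseudometric qdist ;
  qdist_T0 : forall x y, qdist x y = 0 -> qdist y x = 0 -> x = y
}.

(* A copy of X, depending on d, carrying the metric dsym d: on it nbhs, closed,
   cauchy and --> are those of the topology (resp. uniformity) of dsym d. *)
Definition sym_space (R : realType) (X : Type)
  (d : T0_quasi_pseudometric R X) : Type := X.

Definition dsym (R : realType) (X : Type) (d : T0_quasi_pseudometric R X)
  (x y : X) : R := Num.max (d x y) (d y x).

Section symmetrization.
Context {R : realType} {X : Type} (d : T0_quasi_pseudometric R X).

HB.instance Definition _ := gen_eqMixin (sym_space d).
HB.instance Definition _ := gen_choiceMixin (sym_space d).

Let dsymxx (x : sym_space d) : dsym d x x = 0.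
Proof. by rewrite /dsym (qpm_refl (qdist_qpm d)) maxxx. Qed.

Let dsym_eq0 (x y : sym_space d) : dsym d x y = 0 -> x = y.
Proof.
move=> xy0; have := qpm_ge0 (qdist_qpm d); move=> d0.
have : dsym d x y <= 0 by rewrite xy0.
rewrite /dsym ge_max => /andP[xy yx].
by apply: (@qdist_T0 _ _ d); apply/eqP; rewrite eq_le ?xy ?yx d0.
Qed.

Let dsymC (x y : sym_space d) : dsym d x y = dsym d y x.
Proof. by rewrite /dsym maxC. Qed.

Let dsym_triangle (y x z : sym_space d) :
  dsym d x z <= dsym d x y + dsym d y z.
Proof.
have tri := qpm_triangle (qdist_qpm d).
rewrite {1}/dsym ge_max; apply/andP; split.
  by apply: (le_trans (tri x y z)); rewrite lerD// le_max lexx.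
by apply: (le_trans (tri z y x)); rewrite addrC lerD// le_max lexx orbT.
Qed.

HB.instance Definition _ :=
  @isMetric.Build R (sym_space d) (dsym d) dsymxx dsym_eq0 dsymC dsym_triangle.

End symmetrization.

Section notions.
Context {R : realType} {X : Type} (d : T0_quasi_pseudometric R X).

Definition bicomplete : Prop :=
  forall u : nat -> sym_space d,
    cauchy (u @ \oo) -> exists l : sym_space d, u @ \oo --> l.

Definition qpm_bounded (A : set X) : Prop :=
  exists2 M : R, 0 < M & forall x y, A x -> A y -> d x y < M.

Definition CB : set (set X) :=
  [set A | [/\ A !=set0, qpm_bounded A & closed (A : set (sym_space d))]].

(* Distances to and between sets are taken in \bar R, so that no boundedness
   assumption is needed for the suprema to be meaningful. *)
Definition dist_pt_set (x : X) (A : set X) : \bar R :=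
  ereal_inf [set (d x a)%:E | a in A].

Definition dist_set_pt (A : set X) (x : X) : \bar R :=
  ereal_inf [set (d a x)%:E | a in A].

Definition qHausdorff (A B : set X) : \bar R :=
  Order.max (ereal_sup [set dist_pt_set a B | a in A])
            (ereal_sup [set dist_set_pt A b | b in B]).

Definition approximate_mix_point (F : X -> set X) : Prop :=
  ereal_inf [set ereal_sup [set (dsym d x y)%:E | y in F x] | x in [set: X]]
    = 0%E.

End notions.

Definition upper_semicontinuous_on (R : realType) (A : set R) (f : R -> R) :
    Prop :=
  forall x, A x -> forall a, f x < a ->
    \forall y \near within A (nbhs x), f y < a.

(* Main.v *)
(* If all points of F x are within e of x, and all points of F x' within e' of
   x', then d x x' <= e + e' + psi (d x x').  Since t - psi t is bounded away
   from 0 on each [delta, oo) (compactness on [delta, M], the liminf condition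
   beyond M), points which are better and better approximate mix-points form a
   Cauchy sequence.  If l is its limit, the contraction condition in both
   orders puts every point of F l at dsym-distance 0 from l, so F l = {l}. *)
Require Import Defs.
From mathcomp Require Import all_boot all_order all_algebra.
From mathcomp Require Import all_classical all_reals all_analysis.
From mathcomp Require Import lra.
Import Order.TTheory GRing.Theory Num.Theory.
Import numFieldNormedType.Exports.
Local Open Scope classical_set_scope.
Local Open Scope ring_scope.

Lemma einf_pinfty_gt0 (R : realType) (f : R -> R) :
  (0 < limf_einf (fun t => (f t)%:E) (pinfty_nbhs R))%E ->
  exists M c : R, 0 < c /\ forall t, M < t -> c <= f t.
Proof.
rewrite limf_einfE => /ereal_sup_gt[_ [V [M [_ MV]] <-]] inf0.
have [r r0 rinf] : exists2 r : R, 0 < r &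
    (r%:E <= ereal_inf [set (f t)%:E | t in V])%E.
  case: (ereal_inf _) inf0 => [r| |]//; first by rewrite lte_fin; exists r.
  (* When the infimum is [+oo], any positive real is a lower bound; 1 is taken. *)
  by exists 1; rewrite ?leey.
exists M, r; split=> // t /MV Vt; rewrite -lee_fin.
by apply: (le_trans rinf); apply: ereal_inf_lbound; exists t.
Qed.

Lemma usc_gap (R : realType) (psi : R -> R) :
  upper_semicontinuous_on `[0, +oo[ psi ->
  (forall t, 0 < t -> psi t < t) ->
  (0 < limf_einf (fun t : R => (t - psi t)%:E) (pinfty_nbhs R))%E ->
  forall delta, 0 < delta ->
  exists2 eta, 0 < eta & forall t, delta <= t -> eta <= t - psi t.
Proof.
move=> usc lt_psi /einf_pinfty_gt0[M [c [c0 cM]]] delta delta0.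
(* Compactness in its near-covering form: a bound that holds around each point of the segment for
   all small [eta] holds on the whole segment for all small [eta]. *)
have : \forall eta \near (0 : R)^'+,
    `[delta, M] `<=` [set t | eta <= t - psi t].
  have /compact_near_coveringP/near_covering_withinP :=
    @segment_compact R delta M.
  apply=> t; rewrite /= in_itv/= => /andP[delta_t _].
  have t0 : 0 < t by exact: lt_le_trans delta_t.
  have gap0 : 0 < t - psi t by rewrite subr_gt0 lt_psi.
  (* The gap at [t] is cut into thirds: near [t], one is lost to the growth of [psi], one to [y]
     falling below [t], and the last remains as a lower bound for [y - psi y]. *)
  have uscP : psi t < psi t + (t - psi t) / 3 by lra.
  have near_psi : \forall y \near t, `[0, +oo[%classic y ->
      psi y < psi t + (t - psi t) / 3.
    by apply: usc uscP; rewrite /= in_itv/= andbT ltW.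
  exists ([set y | delta <= y -> y - psi y >= (t - psi t) / 3],
          [set eta | eta <= (t - psi t) / 3]) => /=; last first.
    move=> [y eta]/= [gap_y eta_le] /andP[delta_y _].
    exact: le_trans (gap_y delta_y).
  split.
    near=> y => delta_y.
    have psiy : psi y < psi t + (t - psi t) / 3.
      have : `[0, +oo[%classic y.
        by rewrite /= in_itv/= andbT (le_trans (ltW delta0)).
      by near: y.
    have yt : t - (t - psi t) / 3 < y.
      by near: y; apply: lt_nbhsr; lra.
    by lra.
  by apply: nbhs_right_le; rewrite divr_gt0.
move=> near_gap.
have [eta [eta0 etac gap]] : exists eta, [/\ 0 < eta, eta <= c &
    `[delta, M] `<=` [set t | eta <= t - psi t]].
  near (0 : R)^'+ => eta.
  exists eta; split=> //.
  - by near: eta; exact: nbhs_right_le.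
  - by near: eta.
exists eta => // t delta_t; have [tM|Mt] := leP t M.
  by apply: gap; rewrite /= in_itv/= delta_t.
exact: le_trans (cM _ Mt).
Unshelve. all: by end_near.
Qed.

Section quasi_pseudometric.
Context {R : realType} {X : Type} (d : T0_quasi_pseudometric R X).

Lemma dsym_le (x y : X) (e : R) :
  (dsym d x y <= e) = (d x y <= e) && (d y x <= e).
Proof. by rewrite /dsym ge_max. Qed.

Lemma dsym_lt (x y : X) (e : R) :
  (dsym d x y < e) = (d x y < e) && (d y x < e).
Proof. by rewrite /dsym gt_max. Qed.

(** The distance from [a] to [B] is an infimum that need not be attained, hence the slack
    [r < s]. *)
Lemma qHausdorff_ltl {A B : set X} {r s : R} {a : X} :
  (qHausdorff d A B <= r%:E)%E -> r < s -> A a -> exists2 b, B b & d a b < s.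
Proof.
rewrite /qHausdorff ge_max => /andP[supA _] rs Aa.
have : (dist_pt_set d a B < s%:E)%E.
  apply: (@le_lt_trans _ _ r%:E); rewrite ?lte_fin//.
  by apply: le_trans supA; apply: ereal_sup_ubound; exists a.
by move=> /ereal_inf_lt[_ [b Bb <-]]; rewrite lte_fin; exists b.
Qed.

Lemma qHausdorff_ltr {A B : set X} {r s : R} {b : X} :
  (qHausdorff d A B <= r%:E)%E -> r < s -> B b -> exists2 a, A a & d a b < s.
Proof.
rewrite /qHausdorff ge_max => /andP[_ supB] rs Bb.
have : (dist_set_pt d A b < s%:E)%E.
  apply: (@le_lt_trans _ _ r%:E); rewrite ?lte_fin//.
  by apply: le_trans supB; apply: ereal_sup_ubound; exists b.
by move=> /ereal_inf_lt[_ [a Aa <-]]; rewrite lte_fin; exists a.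
Qed.

Lemma approximate_mix_point_ex (F : X -> set X) (e : R) :
  approximate_mix_point d F -> 0 < e ->
  exists x, forall y, F x y -> dsym d x y <= e.
Proof.
move=> F_mix e0.
have : (ereal_inf [set ereal_sup [set (dsym d x y)%:E | y in F x]
  | x in [set: X]] < e%:E)%E by rewrite F_mix lte_fin.
move=> /ereal_inf_lt[_ [x _ <-]] sup_lt; exists x => y Fxy.
rewrite -lee_fin; apply: le_trans (ltW sup_lt).
by apply: ereal_sup_ubound; exists y.
Qed.

Section contraction.
Variables (F : X -> set X) (psi : R -> R).
Hypothesis F_contr :
  forall x y, (qHausdorff d (F x) (F y) <= (psi (d x y))%:E)%E.
Hypothesis F_neq0 : forall x, F x !=set0.

Let tri := qpm_triangle (qdist_qpm d).

(** Go from [x] to some [a] in [F x], on to some [b] in [F x'], then to [x']; the middle leg costs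
    [psi (d x x')] up to an arbitrarily small [eps]. *)
Lemma approximate_mix_dist {x x' : X} {e e' : R} :
  (forall y, F x y -> dsym d x y <= e) ->
  (forall y, F x' y -> dsym d x' y <= e') ->
  d x x' <= e + e' + psi (d x x').
Proof.
move=> mix_x mix_x'; apply/ler_addgt0Pr => eps eps0.
have [a Fa] := F_neq0 x.
have psi_lt : psi (d x x') < psi (d x x') + eps by rewrite ltrDl.
have [b Fb ab] := qHausdorff_ltl (F_contr x x') psi_lt Fa.
have := mix_x a Fa; rewrite dsym_le => /andP[xa _].
have := mix_x' b Fb; rewrite dsym_le => /andP[_ bx'].
have := tri x a x'; have := tri a b x'.
by lra.
Qed.

Lemma approximate_mix_limit {l b : X} :
  (forall t, 0 <= t -> psi t <= t) ->
  (forall eps, 0 < eps -> exists2 x, dsym d l x < eps &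
    forall y, F x y -> dsym d x y <= eps) ->
  F l b -> l = b.
Proof.
move=> psi_le approx Flb.
suff : forall eps, 0 < eps -> dsym d l b <= 0 + eps.
  move/ler_addgt0Pr; rewrite dsym_le => /andP[lb bl].
  have d_ge0 := qpm_ge0 (qdist_qpm d).
  by apply: (@qdist_T0 _ _ d); apply/eqP; rewrite eq_le ?lb ?bl d_ge0.
move=> eps eps0; rewrite add0r.
have eps4 : 0 < eps / 4 by rewrite divr_gt0.
have [x] := approx _ eps4; rewrite dsym_lt => /andP[lx xl] mix_x.
have psi_lt y z : d y z < eps / 4 -> psi (d y z) < eps / 2.
  by move=> yz; have := psi_le (d y z) (qpm_ge0 (qdist_qpm d) _ _); lra.
(* As [d] is not symmetric, [a] serves the path l, x, a, b and [a'] the way back b, a', x, l. Each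
   path costs at most eps/4 + eps/4 + eps/2. *)
have [a Fa ab] := qHausdorff_ltr (F_contr x l) (psi_lt _ _ xl) Flb.
have [a' Fa' ba'] := qHausdorff_ltl (F_contr l x) (psi_lt _ _ lx) Flb.
have := mix_x a Fa; rewrite dsym_le => /andP[xa _].
have := mix_x a' Fa'; rewrite dsym_le => /andP[_ a'x].
rewrite dsym_le; apply/andP; split.
  by have := tri l x b; have := tri x a b; lra.
by have := tri b a' l; have := tri a' x l; lra.
Qed.

End contraction.
End quasi_pseudometric.

(* psi : [0, oo) -> [0, oo) is the restriction to [0, oo) of psi : R -> R;
   its values at negative reals are irrelevant.  The normalization psi 0 = 0 is
   tacit in the source: d x y = 0 may hold with x <> y, and without it the
   claim fails (d x y := max(y - x, 0) on R, psi 0 := 1, psi t := t / (1 + t)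
   for t > 0, F x := {x / (1 + x)} if x > 0 and F x := {1} otherwise). *)
Theorem corollary30 (R : realType) (X : Type) (d : T0_quasi_pseudometric R X)
  (F : X -> set X) (psi : R -> R)
  (X_nonempty : [set: X] !=set0)
  (d_bicomplete : bicomplete d)
  (F_CB : forall x, CB d (F x))
  (psi_ge0 : forall t, 0 <= t -> 0 <= psi t)
  (F_contr : forall x y, (qHausdorff d (F x) (F y) <= (psi (d x y))%:E)%E)
  (psi_usc : upper_semicontinuous_on `[0, +oo[ psi)
  (psi_lt : forall t, 0 < t -> psi t < t)
  (psi_0 : psi 0 = 0)
  (psi_liminf : (0 < limf_einf (fun t : R => (t - psi t)%:E) (pinfty_nbhs R))%E)
  (F_mix : approximate_mix_point d F) :
  exists x, F x x.
Proof.
have F_neq0 x : F x !=set0 by case: (F_CB x).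
have gap := usc_gap _ _ psi_usc psi_lt psi_liminf.
have psi_le t : 0 <= t -> psi t <= t.
  by rewrite le_eqVlt => /predU1P[<-|/psi_lt/ltW//]; rewrite psi_0.
have mix_ex (n : nat) : exists x : sym_space d,
    forall y, F x y -> dsym d x y <= n.+1%:R^-1.
  by apply: approximate_mix_point_ex; rewrite ?invr_gt0.
have [u mix_u] := boolp.choice mix_ex.
have mix_u_near (eps : R) : 0 < eps ->
    \forall n \near \oo, forall y, F (u n) y -> dsym d (u n) y <= eps.
  move=> eps0; near=> n => y /mix_u /le_trans; apply; apply: ltW.
  by near: n; exact: (near_infty_natSinv_lt (PosNum eps0)).
have cauchy_u : cauchy (u @ \oo).
  apply: cauchy_exP => delta delta0; have [eta eta0 gap_eta] := gap _ delta0.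
  (* Two mix-points of quality eta/3 satisfy d - psi d <= 2 eta/3 < eta, which rules out delta <=
     d. *)
  have eta3 : 0 < eta / 3 by rewrite divr_gt0.
  have [N _ mix_N] := mix_u_near _ eta3.
  have d_lt m n : (N <= m)%N -> (N <= n)%N -> d (u m) (u n) < delta.
    move=> /mix_N mix_m /mix_N mix_n.
    have := approximate_mix_dist _ _ _ F_contr F_neq0 mix_m mix_n.
    by case: ltP => // /gap_eta; lra.
  exists (u N), N => // n /= Nn.
  have : dsym d (u N) (u n) < delta by rewrite dsym_lt !d_lt.
  by rewrite ballEmdist.
have [l ul] := d_bicomplete _ cauchy_u.
have [b Flb] := F_neq0 l.
exists l; suff {2}-> : l = b by [].
(* A late [u n] is both close to [l] and a good approximate mix-point. *)
apply: (approximate_mix_limit _ _ _ F_contr psi_le _ Flb) => eps eps0.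
near \oo => n; exists (u n); last by near: n; exact: mix_u_near.
have : ball l eps (u n) by near: n; move/cvg_ballP: ul; apply.
by rewrite ballEmdist.
Unshelve. all: by end_near.
Qed.
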